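(* Let $N,M$ be the numbers of data samples (from the density $q$) and noise samples (from the density $n$), and let $\xi^*={\rm arg}\min_\xi d_{\rm NCE}(q,p_\xi)$. Assume that the model includes the true distribution: $q(x)=p(x\mid\xi^* )$. Assume also the regularity conditions (N1)-(N5) stated in the context. Write $p_*(z)=p(z\mid\xi^* )$ and $$r(z)=\frac{N}{N+M}p_*(z)+\frac{M}{N+M}n(z),\qquad b(z)=\frac{p_*(z)\,n(z)}{r(z)^2}.$$ Then $${\rm tr}\left\{I(\xi^* )J(\xi^* )^{-1}\right\}=m-{\rm E}_r\{b(z)\},$$ where $m=\dim(\xi)$, the matrices $I,J$ are defined in the context, and ${\rm E}_r$ denotes the expectation with respect to $z\sim r(z)$.
   Context: Model. All distributions have densities on $\mathbb R^d$ or a subset of it. A non-normalized model is given by nonnegative functions $\widetilde p(x\mid\theta)$, with normalized version $p(x\mid\theta)=\widetilde p(x\mid\theta)/Z(\theta)$, $Z(\theta)=\int\widetilde p(x\mid\theta)\,{\rm d}x$. The parameter $\theta$ is identifiable and has a compact parameter space $\Theta\subset\mathbb R^{m-1}$. In noise contrastive estimation the model is rewritten as $\log p(x\mid\theta,c)=\log\widetilde p(x\mid\theta)+c$, where $c$ is regarded as an additional parameter. Write $\xi=(\theta,c)$, $m=\dim(\xi)=\dim(\theta)+1$, and $p_\xi(x)=p(x\mid\xi)=p(x\mid\theta,c)$; in general $p_\xi$ need not integrate to one. Functions. $$\rho_d(x,\xi)=-\log\frac{Np(x\mid\xi)}{Np(x\mid\xi)+Mn(x)},\qquad \rho_n(y,\xi)=-\log\frac{Mn(y)}{Np(y\mid\xi)+Mn(y)},$$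 $$d_{\rm NCE}(q,p_\xi)=-\int q(x)\log\frac{Np(x\mid\xi)}{Np(x\mid\xi)+Mn(x)}\,{\rm d}x-\frac MN\int n(y)\log\frac{Mn(y)}{Np(y\mid\xi)+Mn(y)}\,{\rm d}y.$$ ${\rm E}_q,{\rm Cov}_q$ (resp. ${\rm E}_n,{\rm Cov}_n$) denote expectation and covariance matrix for $z\sim q$ (resp. $z\sim n$); $\nabla_\xi,\nabla_\xi^2$ denote gradient and Hessian in $\xi$. Matrices ($m\times m$). $$I(\xi)=\frac{N}{N+M}{\rm Cov}_q\{\nabla_\xi\rho_d(z,\xi)\}+\frac{M}{N+M}{\rm Cov}_n\{\nabla_\xi\rho_n(z,\xi)\},$$ $$J(\xi)=\frac{N}{N+M}{\rm E}_q\{\nabla_\xi^2\rho_d(z,\xi)\}+\frac{M}{N+M}{\rm E}_n\{\nabla_\xi^2\rho_n(z,\xi)\}.$$ Conditions. (N1) For every $\theta$, the support of $p(z\mid\theta)$ is included in that of $n(z)$. (N2) For every $z$, $\log p(z\mid\theta)$ is three times continuously differentiable over $\Theta$. (N3) Both ${\rm E}_q\{\nabla_\xi\rho_d(z,\xi^* )\nabla_\xi\rho_d(z,\xi^* )^\top\}$ and ${\rm E}_n\{\nabla_\xi\rho_n(z,\xi^* )\nabla_\xi\rho_n(z,\xi^* )^\top\}$ are finite. (N4) There exist functions $b_d(z)$ and $b_n(z)$ with ${\rm E}_q\{b_d(z)\}<\infty$ and ${\rm E}_n\{b_n(z)\}<\infty$ such that, for all $i,j,k$ and $\xi$, $|\rho_d(z,\xi)|$,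 $|\partial^2\rho_d(z,\xi)/\partial\xi_i\partial\xi_j|$ and $|\partial^3\rho_d(z,\xi)/\partial\xi_i\partial\xi_j\partial\xi_k|$ are all at most $b_d(z)$, and $|\rho_n(z,\xi)|$, $|\partial^2\rho_n(z,\xi)/\partial\xi_i\partial\xi_j|$ and $|\partial^3\rho_n(z,\xi)/\partial\xi_i\partial\xi_j\partial\xi_k|$ are all at most $b_n(z)$. (N5) The matrix $J(\xi^* )$ is nonsingular. *)

(* Defs.v *)
From HB Require Import structures.
From mathcomp Require Import all_boot all_order all_algebra.
From mathcomp Require Import all_classical all_reals all_analysis.
Set Implicit Arguments. Unset Strict Implicit. Unset Printing Implicit Defensive.
Import Order.TTheory GRing.Theory Num.Theory.
Import numFieldNormedType.Exports.
Local Open Scope classical_set_scope.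
Local Open Scope ring_scope.

(* Lebesgue measure on R^d, realized on d.-tuple R with its product
   sigma-algebra: Dirac mass in dimension 0, then the image of
   (Lebesgue on R) \x (Lebesgue on R^d) under (a, t) |-> a :: t. *)
Section lebesgue_Rd.
Context {R : realType}.
Local Notation R1 := (measurableTypeR R).

Section step.
Variables (d : nat) (mu : {sigma_finite_measure set (d.-tuple R1) -> \bar R}).
Local Open Scope ereal_scope.

Local Notation prod1 := (@lebesgue_measure R \x mu).
Let tcons (x : (R1 * d.-tuple R1)%type) : d.+1.-tuple R1 := [tuple of x.1 :: x.2].
Let uncons (t : d.+1.-tuple R1) : (R1 * d.-tuple R1)%type :=
  (thead t, [tuple of behead t]).

Let measurable_tcons : measurable_fun setT tcons.
Proof. exact: measurable_cons. Qed.

Let measurable_uncons : measurable_fun setT uncons.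
Proof.
apply/measurable_fun_pairP; split.
  rewrite [X in measurable_fun _ X](_ : _ = @tnth _ R1 ^~ ord0) //.
  exact: measurable_tnth.
exact: measurable_behead.
Qed.

Let tconsK : cancel tcons uncons.
Proof. by move=> [x t]; congr pair; apply/val_inj. Qed.

Definition lebesgue_step : set (d.+1.-tuple R1) -> \bar R :=
  pushforward prod1 tcons.

Let push : {measure set (d.+1.-tuple R1) -> \bar R} :=
  measure_function_pushforward__canonical__measure_function_Measure
    prod1 measurable_tcons.

Let lebesgue_step0 : lebesgue_step set0 = 0.
Proof. exact: (measure0 push). Qed.

Let lebesgue_step_ge0 A : 0 <= lebesgue_step A.
Proof. exact: (measure_ge0 push). Qed.

Let lebesgue_step_sigma_additive : semi_sigma_additive lebesgue_step.
Proof. exact: (@measure_semi_sigma_additive _ _ _ push). Qed.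

HB.instance Definition _ := isMeasure.Build _ _ _ lebesgue_step
  lebesgue_step0 lebesgue_step_ge0 lebesgue_step_sigma_additive.

Let lebesgue_step_sigma_finite : sigma_finite setT lebesgue_step.
Proof.
have [[F TF mF]] : isSigmaFinite.axioms_ _ _ _ prod1.
  (* named explicitly: canonical inference only finds the instance for
     products of subprobabilities *)
  exact: lebesgue_integral_fubini.measure_function_Measure_isSigmaFinite__to__measure_function_isSigmaFinite.
exists (fun i => uncons @^-1` F i).
  by rewrite -preimage_bigcup -TF preimage_setT.
move=> i; have [mFi Foo] := mF i; split.
  by rewrite -[X in measurable X]setTI; exact: measurable_uncons.
rewrite /lebesgue_step /pushforward -comp_preimage.
by rewrite (_ : uncons \o _ = id) //; apply/funext => x /=; rewrite tconsK.
Qed.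

HB.instance Definition _ := Measure_isSigmaFinite.Build _ _ _ lebesgue_step
  lebesgue_step_sigma_finite.

End step.

Fixpoint lebesgue_Rd d : {sigma_finite_measure set (d.-tuple R1) -> \bar R} :=
  match d return {sigma_finite_measure set (d.-tuple R1) -> \bar R} with
  | 0 => @dirac _ (0.-tuple R1) [tuple] R
  | d'.+1 => lebesgue_step (lebesgue_Rd d')
  end.

Lemma lebesgue_Rd_box d (A : 'I_d -> set R1) :
  (forall i, measurable (A i)) ->
  lebesgue_Rd d [set x | forall i, A i (tnth x i)] =
  (\prod_(i < d) lebesgue_measure (A i))%E.
Proof.
elim: d => [|d IH] in A *; move=> mA.
  by rewrite big_ord0 /= diracE mem_set // => -[].
rewrite big_ord_recl -IH //=.
rewrite /lebesgue_step /pushforward.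
rewrite -product_measure1E //.
  congr (_ _); apply/seteqP; split => [[x t] /= h|[x t] /= [h0 h] i].
    by split; [exact: (h ord0)|move=> i; have := h (lift ord0 i); rewrite tnthS].
  have [j ->|->] := unliftP ord0 i; by [rewrite tnthS|].
rewrite (_ : mkset _ = \bigcap_(i in [set: 'I_d]) (@tnth _ R1 ^~ i) @^-1` A (lift ord0 i)).
  apply: fin_bigcap_measurable => // i _.
  by rewrite -[X in measurable X]setTI; exact: measurable_tnth.
by apply/seteqP; split => x /= h i //=; apply: h.
Qed.

End lebesgue_Rd.

Notation Rd R d := (d.-tuple (measurableTypeR R)).

Section partial_derivatives.
Context {R : realType} {m : nat}.
Implicit Types (f : 'rV[R]_m -> R) (U K : set 'rV[R]_m).

Definition partial (i : 'I_m) f : 'rV[R]_m -> R :=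
  fun x => 'D_(delta_mx 0 i) f x.

Definition gradient f (x : 'rV[R]_m) : 'rV[R]_m := \row_i partial i f x.

Definition hessian f (x : 'rV[R]_m) : 'M[R]_m :=
  \matrix_(i, j) partial i (partial j f) x.

Fixpoint partials_exist (n : nat) U f : Prop :=
  if n is n'.+1 then
    forall i, (forall x, U x -> derivable f x (delta_mx 0 i)) /\
              partials_exist n' U (partial i f)
  else True.

Fixpoint continuously_diff (n : nat) U f : Prop :=
  (forall x, U x -> {for x, continuous f}) /\
  (if n is n'.+1 then
     forall i, (forall x, U x -> derivable f x (delta_mx 0 i)) /\
               continuously_diff n' U (partial i f)
   else True).

(* "f is P over K" for a set K that need not be open: P on some open
   neighbourhood of K. *)
Definition around K (P : set 'rV[R]_m -> Prop) : Prop :=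
  exists U, [/\ open U, K `<=` U & P U].

End partial_derivatives.

Section densities.
Context {R : realType} {d : nat}.
Implicit Types (X : set (Rd R d)) (f g : Rd R d -> R).
Local Notation leb := (@lebesgue_Rd R d).

Definition is_density X f : Prop :=
  [/\ (forall x, X x -> 0 <= f x), measurable_fun X f &
      (\int[leb]_(x in X) (f x)%:E = 1)%E].

(* Expectation of g(z) for z distributed with density f on X. *)
Definition expect X f g : R := \int[leb]_(x in X) (f x * g x).

Definition has_expect X f g : Prop :=
  leb.-integrable X (fun x => (f x * g x)%:E).

Definition covmx X f m (G : Rd R d -> 'rV[R]_m) : 'M[R]_m :=
  \matrix_(i, j) expect X f (fun x =>
    (G x 0 i - expect X f (fun y => G y 0 i)) *
    (G x 0 j - expect X f (fun y => G y 0 j))).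

Definition expectmx X f m (G : Rd R d -> 'M[R]_m) : 'M[R]_m :=
  \matrix_(i, j) expect X f (fun x => G x i j).

End densities.

(* Non-normalized model ptilde(x | theta), theta in R^k.  The functions are
   given for all theta in R^k (e.g. extended by 0), so that derivatives make
   sense at boundary points of Theta; all other requirements are on Theta. *)
Section model.
Context {R : realType} {d k : nat}.
Variables (X : set (Rd R d)) (ptilde : Rd R d -> 'rV[R]_k -> R).
Local Notation leb := (@lebesgue_Rd R d).

Definition partition_fun (theta : 'rV[R]_k) : R :=
  \int[leb]_(x in X) ptilde x theta.

Definition normalized (x : Rd R d) (theta : 'rV[R]_k) : R :=
  ptilde x theta / partition_fun theta.

Record nonnormalized_model (Theta : set 'rV[R]_k) : Prop := {
  model_ge0 : forall x theta, X x -> 0 <= ptilde x theta;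
  model_measurable : forall theta, measurable_fun X (ptilde ^~ theta);
  model_normalizable : forall theta, Theta theta ->
    (0 < \int[leb]_(x in X) (ptilde x theta)%:E < +oo)%E;
  model_compact : compact Theta;
  model_identifiable : forall theta1 theta2, Theta theta1 -> Theta theta2 ->
    {ae leb, forall x, X x -> normalized x theta1 = normalized x theta2} ->
    theta1 = theta2 }.

(* xi = (theta, c) is a row vector of size k + 1 whose last entry is c. *)
Definition theta_of (xi : 'rV[R]_(k + 1)) : 'rV[R]_k := lsubmx xi.
Definition c_of (xi : 'rV[R]_(k + 1)) : R := rsubmx xi 0 0.

(* log p(x | theta, c) = log ptilde(x | theta) + c *)
Definition pxi (x : Rd R d) (xi : 'rV[R]_(k + 1)) : R :=
  ptilde x (theta_of xi) * expR (c_of xi).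

(* The range C of c is left arbitrary rather than fixed to R: bounds on |rho_d|
   and |rho_n| uniform in xi cannot hold for unbounded c. *)
Definition xi_space (Theta : set 'rV[R]_k) (C : set R) : set 'rV[R]_(k + 1) :=
  [set xi | Theta (theta_of xi) /\ C (c_of xi)].

End model.

Definition is_argmin {R : realType} T (A : set T) (F : T -> \bar R) (x : T) :=
  A x /\ forall y, A y -> (F x <= F y)%E.

Section nce.
Context {R : realType} {d m : nat}.
Variables (N M : nat) (X : set (Rd R d)) (n : Rd R d -> R).
Variable p : Rd R d -> 'rV[R]_m -> R.
Local Notation leb := (@lebesgue_Rd R d).

Definition rho_d (x : Rd R d) (xi : 'rV[R]_m) : R :=
  - ln (N%:R * p x xi / (N%:R * p x xi + M%:R * n x)).

Definition rho_n (y : Rd R d) (xi : 'rV[R]_m) : R :=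
  - ln (M%:R * n y / (N%:R * p y xi + M%:R * n y)).

Definition d_nce (q : Rd R d -> R) (xi : 'rV[R]_m) : \bar R :=
  ((- (\int[leb]_(x in X)
         (q x * ln (N%:R * p x xi / (N%:R * p x xi + M%:R * n x)))%:E))
   - ((M%:R / N%:R)%:E * (\int[leb]_(y in X)
         (n y * ln (M%:R * n y / (N%:R * p y xi + M%:R * n y)))%:E)))%E.

Definition I_mx (q : Rd R d -> R) (xi : 'rV[R]_m) : 'M[R]_m :=
  (N%:R / (N%:R + M%:R)) *: covmx X q (fun z => gradient (rho_d z) xi) +
  (M%:R / (N%:R + M%:R)) *: covmx X n (fun z => gradient (rho_n z) xi).

Definition J_mx (q : Rd R d -> R) (xi : 'rV[R]_m) : 'M[R]_m :=
  (N%:R / (N%:R + M%:R)) *: expectmx X q (fun z => hessian (rho_d z) xi) +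
  (M%:R / (N%:R + M%:R)) *: expectmx X n (fun z => hessian (rho_n z) xi).

Definition finite_second_moments (q : Rd R d -> R) (xi : 'rV[R]_m) : Prop :=
  forall i j : 'I_m,
    has_expect X q
      (fun z => gradient (rho_d z) xi 0 i * gradient (rho_d z) xi 0 j) /\
    has_expect X n
      (fun z => gradient (rho_n z) xi 0 i * gradient (rho_n z) xi 0 j).

Definition bounded_by (Xi : set 'rV[R]_m) (f : 'rV[R]_m -> R) (B : R) : Prop :=
  forall xi, Xi xi -> forall i j l : 'I_m,
    [/\ `|f xi| <= B, `|partial i (partial j f) xi| <= B &
        `|partial i (partial j (partial l f)) xi| <= B].

(* The bounds on the derivatives presuppose that these exist, which is made
   explicit ('D_v f is a junk value at points where f is not derivable). *)
Definition dominated (q : Rd R d -> R) (Xi : set 'rV[R]_m) : Prop :=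
  exists b_d b_n : Rd R d -> R,
    [/\ has_expect X q b_d, has_expect X n b_n &
        forall z, X z ->
          [/\ around Xi (fun U => partials_exist 3 U (rho_d z)),
              around Xi (fun U => partials_exist 3 U (rho_n z)),
              bounded_by Xi (rho_d z) (b_d z) &
              bounded_by Xi (rho_n z) (b_n z)]].

Definition r_mix (xi : 'rV[R]_m) (z : Rd R d) : R :=
  N%:R / (N%:R + M%:R) * p z xi + M%:R / (N%:R + M%:R) * n z.

Definition b_fun (xi : 'rV[R]_m) (z : Rd R d) : R :=
  p z xi * n z / r_mix xi z ^+ 2.

End nce.

Section model_conditions.
Context {R : realType} {d k : nat}.
Variables (X : set (Rd R d)) (ptilde : Rd R d -> 'rV[R]_k -> R).
Variable Theta : set 'rV[R]_k.
Local Notation p := (normalized X ptilde).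

Definition support_included (n : Rd R d -> R) : Prop :=
  forall theta, Theta theta ->
    X `&` [set z | 0 < p z theta] `<=` [set z | 0 < n z].

(* Points z outside the support of the whole model, where log p(z | theta) is
   identically -oo, are allowed; at every other z it is finite and C^3. *)
Definition log_model_C3 : Prop :=
  forall z, X z -> around Theta (fun U =>
    (forall theta, U theta -> p z theta = 0) \/
    ((forall theta, U theta -> 0 < p z theta) /\
     continuously_diff 3 U (fun theta => ln (p z theta)))).

End model_conditions.

(* Main.v *)
(* On the set where n > 0, exp (- rho_d) and exp (- rho_n) are the posterior
   probabilities of data and noise, so they sum to 1 when p > 0.  (When p = 0
   both losses are 0 and the sum is 2; being two-valued and continuous along
   lines, the sum is locally constant along each coordinate line in any case.)
   Differentiating it once and twice gives, at every point of the sample space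
   and with D = N p + M n,
     N p grad rho_d + M n grad rho_n = 0,
     N p hess rho_d + M n hess rho_n
       = N p (grad rho_d)^T grad rho_d + M n (grad rho_n)^T grad rho_n.
   Integrated at xi*, where p = q, the second identity says that J is the
   uncentred second moment in I, and the first relates the two means, so that
   I = J - ((N + M)^2 / (N M)) v v^T with v = M / (N + M) E_n (grad rho_n).
   The normalizing parameter c has rho_n - rho_d = c + const along its axis,
   which makes v the column of J indexed by c and v_c = N M / (N + M)^2 E_r b.
   Hence tr (I J^-1) = m - ((N + M)^2 / (N M)) v_c = m - E_r b. *)
Require Import Defs.
From HB Require Import structures.
From mathcomp Require Import all_boot all_order all_algebra.
From mathcomp Require Import all_classical all_reals all_analysis.
From mathcomp Require Import measurable_realfun ring lra.
Set Implicit Arguments. Unset Strict Implicit. Unset Printing Implicit Defensive.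
Import Order.TTheory GRing.Theory Num.Theory.
Import numFieldNormedType.Exports.
Local Open Scope classical_set_scope.
Local Open Scope ring_scope.

(** * Calculus along a single line *)

Section directional_derivatives.
Context {R : realType} {V : normedModType R}.
Implicit Types (f : V -> R) (x v : V).

Lemma derive_line f x v : 'D_v f x = 'D_1 (fun h : R => f (h *: v + x)) 0.
Proof.
rewrite /derive; set g1 := fun h => h^-1 *: _; set g2 := fun h => h^-1 *: _.
suff -> : g1 = g2 by [].
by apply/funext => h; rewrite /g1 /g2 /= addr0 scale0r add0r [_%:A]mulr1.
Qed.

Lemma derive_locally_cst f x v c :
  (\forall h \near (0 : R), f (h *: v + x) = c) -> 'D_v f x = 0.
Proof.
by move=> fc; rewrite derive_line (near_eq_derive (g := cst c))// derive_cst.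
Qed.

Lemma derivable_continuous_line f x v : derivable f x v ->
  f (h *: v + x) @[h --> (0 : R)] --> f x.
Proof.
move=> /derivable1P/derivable1_diffP/differentiable_continuous.
rewrite /continuous_at; rewrite /prop_for /= scale0r add0r.
exact.
Qed.

(** The one-variable chain rule is applied along the line through [x], since derivability along [v]
    gives no differentiability on [V]. *)
Lemma is_derive_expRN f x v : derivable f x v ->
  is_derive x v (fun y => expR (- f y)) (- (expR (- f x) * 'D_v f x)).
Proof.
move=> dfx; have dl := (derivable1P f x v).1 dfx.
pose g (h : R) := f (h *: v + x).
have dg : is_derive (0 : R) 1 g ('D_v f x).
  by split; [exact: dl|rewrite derive_line].
have g0 : g 0 = f x by rewrite /g scale0r add0r.
have := is_derive1_comp (is_derive_expR _) (is_deriveN dg).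
move=> [deg eg]; split; first by apply/derivable1P.
by rewrite derive_line -mulrN -{1}g0; exact: eg.
Qed.

Lemma near_line (U : set V) x v : open U -> U x ->
  \forall h \near (0 : R), U (h *: v + x).
Proof.
move=> oU Ux.
have c : (fun h : R => h *: v + x) @ (0 : R) --> x.
  rewrite -[X in _ --> X]add0r; apply: cvgD; last exact: cvg_cst.
  by rewrite -[X in _ --> X](scale0r v); apply: cvgZr_tmp; exact: cvg_id.
by apply: c; exact: open_nbhs_nbhs.
Qed.

(** Continuity along the line keeps [f] within less than the gap [|a - b|] of its value at [x], so
    it cannot switch to the other value. *)
Lemma locally_cst_two_valued f x v (a b : R) : a != b -> derivable f x v ->
  (forall y, f y = a \/ f y = b) ->
  \forall h \near (0 : R), f (h *: v + x) = f x.
Proof.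
move=> ab /derivable_continuous_line fx fab.
have e0 : 0 < `|a - b| by rewrite normr_gt0 subr_eq0.
move/cvgrPdist_lt : fx => /(_ _ e0); apply: filterS => h.
by case: (fab x) (fab (h *: v + x)) => -> [] ->//;
  rewrite ?ltxx// distrC ltxx.
Qed.

End directional_derivatives.

(** * Pointwise identities between the two logistic losses *)

Section logistic_losses.
Context {R : realType} {m : nat} (P : 'rV[R]_m -> R) (a b : R).
Context (U : set 'rV[R]_m).
Hypotheses (a_gt0 : 0 < a) (b_gt0 : 0 < b) (P_ge0 : forall xi, 0 <= P xi).
Hypothesis oU : open U.

Local Notation rd := (fun xi => - ln (a * P xi / (a * P xi + b))).
Local Notation rn := (fun xi => - ln (b / (a * P xi + b))).
Local Notation e i := (delta_mx 0 i : 'rV[R]_m).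

Hypothesis drd : forall xi i, U xi -> derivable rd xi (e i).
Hypothesis drn : forall xi i, U xi -> derivable rn xi (e i).

Let D_gt0 xi : 0 < a * P xi + b.
Proof. by rewrite ltr_wpDl// mulr_ge0// ltW. Qed.

Let rd_null xi : P xi = 0 -> rd xi = 0.
Proof. by move=> P0; rewrite /= P0 mulr0 mul0r ln0// oppr0. Qed.

Let rn_null xi : P xi = 0 -> rn xi = 0.
Proof. by move=> P0; rewrite /= P0 mulr0 add0r divff ?gt_eqF// ln1 oppr0. Qed.

Let expRNrd xi : P xi != 0 -> expR (- rd xi) = a * P xi / (a * P xi + b).
Proof.
move=> P0; rewrite /= opprK lnK// posrE divr_gt0// mulr_gt0//.
by rewrite lt_neqAle eq_sym P0 P_ge0.
Qed.

Let expRNrn xi : expR (- rn xi) = b / (a * P xi + b).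
Proof. by rewrite /= opprK lnK// posrE divr_gt0. Qed.

Let F xi := expR (- rd xi) + expR (- rn xi).

(* Where [P] vanishes, the junk value [ln 0 = 0] gives [rd = 0], hence [2]. *)
Let FE xi : F xi = if P xi == 0 then 2 else 1.
Proof.
rewrite /F; case: eqVneq => [P0|P0].
  by rewrite rd_null// rn_null// oppr0 expR0.
by rewrite expRNrd// expRNrn -mulrDl divff// gt_eqF.
Qed.

Let is_derive_F xi i : U xi -> is_derive xi (e i) F
  (- (expR (- rd xi) * partial i rd xi) - expR (- rn xi) * partial i rn xi).
Proof.
by move=> Ux; apply: is_deriveD; apply: is_derive_expRN; [exact: drd|exact: drn].
Qed.

Let near_F xi i : U xi -> \forall h \near (0 : R), F (h *: e i + xi) = F xi.
Proof.
move=> Ux; apply: (@locally_cst_two_valued _ _ F xi (e i) 1 2).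
- by rewrite lt_eqF// ltr1n.
- by have [] := is_derive_F i Ux.
- by move=> y; rewrite FE; case: ifP => _; [right|left].
Qed.

(** [F] equals 2 exactly at the zeros of [P] and is locally constant along coordinate lines, so a
    zero of [P] persists nearby on each such line. *)
Lemma near_null xi i : U xi -> P xi = 0 ->
  \forall h \near (0 : R), P (h *: e i + xi) = 0.
Proof.
move=> Ux P0; apply: filterS (near_F i Ux) => h.
rewrite !FE P0 eqxx; case: eqP => // _ /eqP.
by rewrite lt_eqF// ltr1n.
Qed.

Let partial_rn_null xi i : U xi -> P xi = 0 -> partial i rn xi = 0.
Proof.
move=> Ux P0; apply: (@derive_locally_cst _ _ _ _ _ 0).
by apply: filterS (near_null i Ux P0) => h; exact: rn_null.
Qed.

Let partial2_rn_null xi i j : U xi -> P xi = 0 ->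
  partial i (partial j rn) xi = 0.
Proof.
move=> Ux P0; apply: (@derive_locally_cst _ _ _ _ _ 0).
apply: filterS2 (near_line (e i) oU Ux) (near_null i Ux P0) => h.
exact: partial_rn_null.
Qed.

Let score0 xi i : U xi ->
  expR (- rd xi) * partial i rd xi + expR (- rn xi) * partial i rn xi = 0.
Proof.
move=> Ux; have [_] := is_derive_F i Ux.
rewrite (derive_locally_cst (near_F i Ux)) => /eqP.
by rewrite -opprD eq_sym oppr_eq0 => /eqP.
Qed.

(** Multiplying [score0] by [a * P xi + b] turns the posterior probabilities into weights. At a zero
    of [P] the first weight vanishes and [rn] is locally constant along the line. *)
Lemma weighted_score0 xi i : U xi ->
  a * P xi * partial i rd xi + b * partial i rn xi = 0.
Proof.
move=> Ux; have [P0|P0] := eqVneq (P xi) 0.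
  by rewrite partial_rn_null// P0 !(mulr0, mul0r) addr0.
have := score0 i Ux; have := D_gt0 xi; rewrite expRNrd// expRNrn.
move: (partial i _ xi) (partial i _ xi) (P xi) => g h p D0.
by move=> /(congr1 ( *%R (a * p + b))); rewrite mulr0 => <-; field; exact: lt0r_neq0.
Qed.

Hypothesis d2rd : forall xi i j, U xi -> derivable (partial j rd) xi (e i).
Hypothesis d2rn : forall xi i j, U xi -> derivable (partial j rn) xi (e i).

Let information xi i j : U xi ->
  expR (- rd xi) * (partial i (partial j rd) xi - partial i rd xi * partial j rd xi) +
  expR (- rn xi) * (partial i (partial j rn) xi - partial i rn xi * partial j rn xi) = 0.
Proof.
move=> Ux.
(* [G] is the left side of [score0]; it vanishes near [xi] along the line, hence so does its
   derivative. *)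
pose G y := expR (- rd y) * partial j rd y + expR (- rn y) * partial j rn y.
have G0 : 'D_(e i) G xi = 0.
  apply: (@derive_locally_cst _ _ _ _ _ 0).
  by apply: filterS (near_line (e i) oU Ux) => h; exact: score0.
have [_] : is_derive xi (e i) G
    (expR (- rd xi) * partial i (partial j rd) xi +
     partial j rd xi * - (expR (- rd xi) * partial i rd xi) +
     (expR (- rn xi) * partial i (partial j rn) xi +
      partial j rn xi * - (expR (- rn xi) * partial i rn xi))).
  apply: is_deriveD; apply: is_deriveM.
  - exact: (is_derive_expRN (@drd _ i Ux)).
  - exact: (derivableP (@d2rd _ i j Ux)).
  - exact: (is_derive_expRN (@drn _ i Ux)).
  - exact: (derivableP (@d2rn _ i j Ux)).
rewrite G0 => G0'; rewrite [RHS]G0'.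
move: (expR _) (expR _) (partial _ _ _) (partial _ _ _).
by move: (partial _ _ _) (partial _ _ _) (partial _ _ _) (partial _ _ _) => *; ring.
Qed.

(* Differentiating [exp (- rd) + exp (- rn) = 1] twice. *)
Lemma weighted_information xi i j : U xi ->
  a * P xi * partial i (partial j rd) xi + b * partial i (partial j rn) xi =
  a * P xi * (partial i rd xi * partial j rd xi) +
  b * (partial i rn xi * partial j rn xi).
Proof.
move=> Ux; have [P0|P0] := eqVneq (P xi) 0.
  by rewrite partial2_rn_null// partial_rn_null// P0 !(mulr0, mul0r) addr0.
have := information i j Ux; have := D_gt0 xi; rewrite expRNrd// expRNrn.
move: (partial i (partial j _) xi) (partial i (partial j _) xi).
move: (partial i _ xi) (partial j _ xi) (partial i _ xi) (partial j _ xi).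
move: (P xi) => p g g' h h' dg dh D0 /(congr1 ( *%R (a * p + b))).
rewrite mulr0 => E; apply/eqP; rewrite -subr_eq0 -[X in _ == X]E; apply/eqP.
by field; exact: lt0r_neq0.
Qed.

Section normalizing_direction.
Context (c : 'I_m) (xi : 'rV[R]_m).
Hypothesis Pc : forall h : R, P (h *: e c + xi) = P xi * expR h.
Hypothesis Ux : U xi.

(* [rn - rd] is the log density ratio up to a constant. *)
Let partial_rnB : P xi != 0 -> partial c rn xi - partial c rd xi = 1.
Proof.
move=> P0; have P_gt0 : 0 < P xi by rewrite lt_neqAle eq_sym P0 P_ge0.
rewrite /partial -deriveB; [|exact: drn|exact: drd].
rewrite derive_line.
rewrite (_ : (fun h => _) = (fun h : R => h + ln (a * P xi / b))).
  by rewrite deriveD// derive_id derive_cst addr0.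
apply/funext => h; rewrite !fctE Pc.
have aP : 0 < a * (P xi * expR h) by rewrite !mulr_gt0// expR_gt0.
have D0 : 0 < a * (P xi * expR h) + b by rewrite addr_gt0.
rewrite !ln_div ?posrE// ?mulr_gt0// !lnM ?posrE// ?mulr_gt0 ?expR_gt0// expRK.
by ring.
Qed.

(** The two derivatives along [c] have difference 1 and weighted sum 0. Solving this linear system
    makes the one of [rn] the posterior probability of data, [a * P xi / (a * P xi + b)]. *)
Lemma partial_rn_normalizing : b * partial c rn xi = a * P xi * b / (a * P xi + b).
Proof.
have [P0|P0] := eqVneq (P xi) 0.
  by rewrite partial_rn_null// P0 !(mulr0, mul0r).
have E : partial c rn xi = 1 + partial c rd xi by rewrite -(partial_rnB P0) subrK.
have := weighted_score0 c Ux; have := D_gt0 xi; rewrite E.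
move: (partial c rd xi) (P xi) => g p D0 h.
have -> : g = - b / (a * p + b).
  apply: (mulIf (lt0r_neq0 D0)); rewrite divfK ?lt0r_neq0//.
  by apply/eqP; rewrite -subr_eq0 -[X in _ == X]h; apply/eqP; ring.
by field; exact: lt0r_neq0.
Qed.

(** Once the [c]-derivative of [rd] is written as that of [rn] minus 1, the quadratic terms cancel
    by [weighted_score0], which also evaluates the remaining linear term. *)
Lemma weighted_score_normalizing i :
  a * P xi * (partial i rd xi * partial c rd xi) +
  b * (partial i rn xi * partial c rn xi) = b * partial i rn xi.
Proof.
have [P0|P0] := eqVneq (P xi) 0.
  by rewrite !partial_rn_null// P0 !(mulr0, mul0r) addr0.
have E : partial c rd xi = partial c rn xi - 1.
  by rewrite -(partial_rnB P0) opprB addrC subrK.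
have /eqP := weighted_score0 i Ux; rewrite addr_eq0 => /eqP h.
rewrite E mulrA h.
by move: (partial _ _ _) (partial _ _ _) => h1 h2; ring.
Qed.

End normalizing_direction.

End logistic_losses.

(** * Measurability of derivatives in the sample point *)

Section measurable_derivatives.
Context {d : measure_display} {T : measurableType d} {R : realType}.
Context (D : set T).

Lemma measurable_fun_inv (f : T -> R) : (forall z, D z -> 0 <= f z) ->
  measurable_fun D f -> measurable_fun D (fun z => (f z)^-1).
Proof.
(* On nonnegative reals the inverse is the power -1, also at 0, where both are 0. *)
move=> f0 mf; apply: (eq_measurable_fun (fun z => f z `^ (-1))).
  by move=> z; rewrite inE => /f0 ?; rewrite powR_inv1.
by apply: (@measurableT_comp _ _ _ _ _ _ (fun y : R => y `^ (-1))).
Qed.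

Lemma measurable_fun_Nln (f : T -> R) :
  measurable_fun D f -> measurable_fun D (fun z => - ln (f z)).
Proof.
move=> mf; apply: (@measurable_funN _ _ _ _ (fun z => ln (f z))).
by apply: (@measurableT_comp _ _ _ _ _ _ (@ln R)).
Qed.

Context {V : normedModType R}.
Implicit Types (f : T -> V -> R) (x v w : V).

(** Difference quotients with step [1 / (n + 1)]: a countable sequence of steps makes the derivative
    a pointwise limit of measurable functions. *)
Let quot (f : V -> R) x v (n : nat) : R :=
  n.+1%:R * (f (n.+1%:R^-1 *: v + x) - f x).

Let quot_cvg (f : V -> R) x v : derivable f x v ->
  quot f x v n @[n --> \oo] --> 'D_v f x.
Proof.
move=> df.
have -> : quot f x v = (fun h : R => h^-1 *: (f (h *: v + x) - f x)) \o harmonic.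
  by apply/funext => n; rewrite /quot /= invrK.
(* The limit defining the derivative is over punctured neighbourhoods of 0; harmonic steps are
   admissible because they are positive. *)
suff h0 : harmonic n @[n --> \oo] --> (0 : R)^' by exact: cvg_comp h0 df.
move=> A A0.
have hA : \forall n \near \oo, harmonic n != 0 :> R -> A (harmonic n).
  exact: (@cvg_harmonic R [set h | h != 0 -> A h] A0).
by apply: filterS hA => n; apply; rewrite gt_eqF// invr_gt0.
Qed.

Let measurable_quot f x v n : (forall y, measurable_fun D (f ^~ y)) ->
  measurable_fun D (fun z => quot (f z) x v n).
Proof.
by move=> mf; apply: measurable_funM => //; apply: measurable_funB.
Qed.

Lemma measurable_derive f x v : (forall y, measurable_fun D (f ^~ y)) ->
  (forall z, D z -> derivable (f z) x v) ->
  measurable_fun D (fun z => 'D_v (f z) x).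
Proof.
move=> mf df; apply: (@measurable_fun_cvg _ _ _ _ (fun n z => quot (f z) x v n)).
  by move=> n; exact: measurable_quot.
by move=> z Dz; apply: quot_cvg; exact: df.
Qed.

(* The neighbourhood on which the inner derivative exists depends on [z], so
   that derivative is replaced by the upper limit of its difference quotients,
   which is measurable in [z] at every point. *)
Lemma measurable_derive2 f x v w : (forall y, measurable_fun D (f ^~ y)) ->
  (forall z, D z -> \forall h \near (0 : R), derivable (f z) (h *: v + x) w) ->
  (forall z, D z -> derivable (fun y => 'D_w (f z) y) x v) ->
  measurable_fun D (fun z => 'D_v (fun y => 'D_w (f z) y) x).
Proof.
move=> mf df d2f.
pose g z y := fine (limn_esup (fun k => (quot (f z) y w k)%:E)).
have mg y : measurable_fun D (g ^~ y).
  apply: (@measurableT_comp _ _ _ _ _ _ (@fine R)); first exact: fine_measurable.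
  apply: measurable_fun_limn_esup => n; apply/measurable_EFinP.
  exact: measurable_quot.
have gE z y : derivable (f z) y w -> g z y = 'D_w (f z) y.
  move=> dfy; rewrite /g (_ : limn_esup _ = ('D_w (f z) y)%:E)//.
  by apply: (cvg_limn_einf_sup _).2; apply: cvg_EFin; [exact: nearW|exact: quot_cvg].
apply: (@measurable_fun_cvg _ _ _ _ (fun n z => quot (g z) x v n)).
  by move=> n; exact: measurable_quot.
move=> z Dz; apply: cvg_trans (quot_cvg (d2f z Dz)).
(* The quotient evaluates [g z] only at [x] and at line parameter [harmonic n]; both points
   eventually lie where the inner derivative exists. *)
apply: near_eq_cvg; have dz := df z Dz.
have := nbhs_singleton dz; rewrite scale0r add0r => dx.
have hz : \forall n \near \oo, derivable (f z) (@harmonic R n *: v + x) w.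
  exact: (@cvg_harmonic R) _ dz.
by apply: filterS hz => n dn; rewrite /quot !gE.
Qed.

End measurable_derivatives.

(** The inverse of [A] sends column [c] of [A] to the basis vector [c], so cyclicity of the trace
    leaves a single entry of [w]. *)
Lemma mxtrace_rank_one_perturbation (F : comUnitRingType) m (A : 'M[F]_m)
    (w : 'rV[F]_m) (k : F) (c : 'I_m) : A \in unitmx ->
  \tr ((A - k *: (col c A *m w)) *m invmx A) = m%:R - k * w 0 c.
Proof.
move=> uA; rewrite mulmxBl mulmxV// linearB /= mxtrace1; congr (_ - _).
rewrite -scalemxAl linearZ /= mxtrace_mulC; congr (_ * _).
rewrite colE !mulmxA mulVmx// mul1mx mxtrace_mulC -colE.
by rewrite /mxtrace big_ord1 mxE.
Qed.

(** * Expectations under densities *)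

Section expectations.
Context {R : realType} {d : nat} (X : set (Rd R d)).
Hypothesis mX : measurable X.
Local Notation leb := (@lebesgue_Rd R d).
Implicit Types f g h : Rd R d -> R.

Lemma density_integrable f : is_density X f -> leb.-integrable X (EFin \o f).
Proof.
move=> [f0 mf f1]; apply/integrableP; split; first exact/measurable_EFinP.
rewrite (eq_integral (fun x => (f x)%:E)); first by rewrite f1 ltry.
by move=> x; rewrite inE => Xx /=; rewrite ger0_norm// f0.
Qed.

(** The bound [|g| <= 1 + g^2] applies, and a density is integrable. *)
Lemma has_expect_square f g : is_density X f -> measurable_fun X g ->
  has_expect X f (fun x => g x * g x) -> has_expect X f g.
Proof.
move=> df mg ig; have [f0 mf _] := df.
have := integrableD mX (density_integrable df) ig.
apply: le_integrable => //; first exact/measurable_EFinP/measurable_funM.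
move=> x Xx; have fx0 := f0 x Xx.
change (`|(f x * g x)%:E| <= `|(f x + f x * (g x * g x))%:E|)%E.
rewrite !abse_EFin lee_fin.
have g2 : 0 <= g x * g x by rewrite -expr2 sqr_ge0.
rewrite normrM (ger0_norm fx0) [leRHS]ger0_norm; last by rewrite addr_ge0// mulr_ge0.
rewrite -[X in _ <= X + _]mulr1 -mulrDr ler_wpM2l//.
by rewrite ler_norml; apply/andP; split; nra.
Qed.

Lemma has_expect_le f g h : measurable_fun X f -> measurable_fun X g ->
  (forall x, X x -> `|g x| <= h x) -> has_expect X f h -> has_expect X f g.
Proof.
move=> mf mg gh; apply: le_integrable => //.
  exact/measurable_EFinP/measurable_funM.
move=> x Xx; rewrite !abse_EFin lee_fin !normrM ler_wpM2l//.
by rewrite (le_trans (gh x Xx))// ler_norm.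
Qed.

Lemma covariance_expect f g h : is_density X f ->
  has_expect X f g -> has_expect X f h -> has_expect X f (fun x => g x * h x) ->
  expect X f (fun x => (g x - expect X f g) * (h x - expect X f h)) =
  expect X f (fun x => g x * h x) - expect X f g * expect X f h.
Proof.
move=> df ig ih igh; set a := expect X f g; set b := expect X f h.
have i1 := density_integrable df.
have f1 : \int[leb]_(x in X) f x = 1 by rewrite /Rintegral; case: df => _ _ ->.
rewrite /expect.
rewrite (@eq_Rintegral _ _ _ _ _ (fun x =>
  (f x * (g x * h x) + (- b * (f x * g x) + - a * (f x * h x))) + (a * b) * f x));
  last by move=> x _; ring.
have iZ (k : R) (u : Rd R d -> R) : leb.-integrable X (EFin \o u) ->
    leb.-integrable X (EFin \o (fun x => k * u x)).
  by move=> iu; apply: (integrableZl mX k iu).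
have iD (u v : Rd R d -> R) : leb.-integrable X (EFin \o u) ->
    leb.-integrable X (EFin \o v) -> leb.-integrable X (EFin \o (fun x => u x + v x)).
  by move=> iu iv; apply: (integrableD mX iu iv).
have iL := iD _ _ (iZ (- b) _ ig) (iZ (- a) _ ih).
rewrite (RintegralD mX (iD _ _ igh iL) (iZ (a * b) _ i1)).
rewrite (RintegralD mX igh iL) (RintegralD mX (iZ (- b) _ ig) (iZ (- a) _ ih)).
rewrite (RintegralZl _ mX i1) (RintegralZl _ mX ig) (RintegralZl _ mX ih) f1.
by rewrite -/(expect X f g) -/(expect X f h) -/a -/b; ring.
Qed.

(** A single integral is needed because the pointwise identities hold only for the weighted sum of
    data and noise terms. *)
Lemma expect_mixture (q n g h : Rd R d -> R) (a b : R) :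
  has_expect X q g -> has_expect X n h ->
  a * expect X q g + b * expect X n h =
  \int[leb]_(x in X) (a * q x * g x + b * (n x * h x)).
Proof.
move=> ig ih; rewrite /expect -(RintegralZl _ mX ig) -(RintegralZl _ mX ih).
rewrite -(RintegralD mX (integrableZl mX a ig) (integrableZl mX b ih)).
by apply: eq_Rintegral => x _ /=; rewrite -mulrA.
Qed.

End expectations.

Lemma mixture_mxE (F : fieldType) m1 m2 (A B : 'M[F]_(m1, m2)) (s t : F) i j :
  (s / (s + t) *: A + t / (s + t) *: B) i j =
  (s + t)^-1 * (s * A i j + t * B i j).
Proof. by rewrite !mxE; ring. Qed.

(** Here [Sd], [Sn] are uncentred second moments and [ed], [en] means. The last hypothesis
    identifies column [c] of [J] with [b / (a + b) * en]; since [ed] is proportional to [en],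
    centring subtracts a multiple of the square of that column. *)
Lemma mxtrace_moments (F : fieldType) m (I J : 'M[F]_m) (a b : F)
    (Sd Sn : 'I_m -> 'I_m -> F) (ed en : 'I_m -> F) (c : 'I_m) :
  a != 0 -> b != 0 -> a + b != 0 -> J \in unitmx ->
  (forall i j, J i j = (a + b)^-1 * (a * Sd i j + b * Sn i j)) ->
  (forall i j, I i j = (a + b)^-1 *
    (a * (Sd i j - ed i * ed j) + b * (Sn i j - en i * en j))) ->
  (forall i, a * ed i + b * en i = 0) ->
  (forall i, a * Sd i c + b * Sn i c = b * en i) ->
  \tr (I *m invmx J) = m%:R - (a + b) / a * en c.
Proof.
move=> a0 b0 ab0 uJ JE IE e0 Sc.
have Jc i : J i c = b / (a + b) * en i by rewrite JE Sc; field.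
have edE i : ed i = - (b / a) * en i.
  apply: (mulfI a0); apply: (addIr (b * en i)); rewrite e0; field.
  exact: a0.
have -> : I = J - ((a + b) ^+ 2 / (a * b)) *: (col c J *m (col c J)^T).
  apply/matrixP => i j; rewrite IE !mxE big_ord1 !mxE !Jc JE !edE.
  by field; rewrite ab0 a0 b0.
rewrite mxtrace_rank_one_perturbation// !mxE Jc.
by congr (_ - _); field; rewrite ab0 a0 b0.
Qed.

(** * Integration of the pointwise identities at the true parameter *)

Section noise_contrastive_estimation.
Context {R : realType} {d m : nat} (N M : nat) (X : set (Rd R d)).
Context (q n : Rd R d -> R) (p : Rd R d -> 'rV[R]_m -> R).
Context (Xi : set 'rV[R]_m) (xi : 'rV[R]_m) (c : 'I_m).
Hypotheses (N_gt0 : (0 < N)%N) (M_gt0 : (0 < M)%N).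
Hypothesis mX : measurable X.
Hypotheses (q_density : is_density X q) (n_density : is_density X n).
Hypothesis p_ge0 : forall z y, X z -> 0 <= p z y.
Hypothesis p_measurable : forall y, measurable_fun X (p ^~ y).
Hypothesis q_model : forall z, X z -> q z = p z xi.
Hypothesis supp : forall z, X z -> n z = 0 -> p z xi = 0.
Hypothesis p_normalizing : forall z (h : R), X z ->
  p z (h *: delta_mx 0 c + xi) = p z xi * expR h.
Hypothesis Xi_xi : Xi xi.
Hypothesis moments : finite_second_moments N M X n p q xi.
Hypothesis dom : dominated N M X n p q Xi.

Local Notation rd := (rho_d N M n p).
Local Notation rn := (rho_n N M n p).
Local Notation leb := (@lebesgue_Rd R d).
Local Notation a := (N%:R : R).
Local Notation b := (M%:R : R).

Let a_gt0 : 0 < a. Proof. by rewrite ltr0n. Qed.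
Let b_gt0 : 0 < b. Proof. by rewrite ltr0n. Qed.

Let n_ge0 z : X z -> 0 <= n z. Proof. by case: n_density => n0 _ _; exact: n0. Qed.

Let n_measurable : measurable_fun X n. Proof. by case: n_density. Qed.

Let p_n_measurable y : measurable_fun X (fun z => (a * p z y + b * n z)^-1).
Proof.
apply: measurable_fun_inv.
  by move=> z Xz; rewrite addr_ge0// mulr_ge0// ?n_ge0// p_ge0.
by apply: measurable_funD; apply: measurable_funM.
Qed.

Let rd_measurable y : measurable_fun X (rd ^~ y).
Proof.
by apply: measurable_fun_Nln; apply: measurable_funM => //; apply: measurable_funM.
Qed.

Let rn_measurable y : measurable_fun X (rn ^~ y).
Proof.
by apply: measurable_fun_Nln; apply: measurable_funM => //; apply: measurable_funM.
Qed.

Let rd_exist z : X z -> around Xi (fun U => partials_exist 3 U (rd z)).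
Proof. by case: dom => bd [bn [_ _ h]] /h[]. Qed.

Let rn_exist z : X z -> around Xi (fun U => partials_exist 3 U (rn z)).
Proof. by case: dom => bd [bn [_ _ h]] /h[]. Qed.

Let partial_measurable f i : (forall y, measurable_fun X (f ^~ y)) ->
  (forall z, X z -> around Xi (fun U => partials_exist 3 U (f z))) ->
  measurable_fun X (fun z => partial i (f z) xi).
Proof.
move=> mf ef; apply: measurable_derive => // z /ef[U [oU XiU]] /(_ i)[df _].
exact/df/XiU.
Qed.

Let partial2_measurable f i j : (forall y, measurable_fun X (f ^~ y)) ->
  (forall z, X z -> around Xi (fun U => partials_exist 3 U (f z))) ->
  measurable_fun X (fun z => partial i (partial j (f z)) xi).
Proof.
move=> mf ef; apply: measurable_derive2 => // z /ef[U [oU XiU]] /(_ j)[df d2f].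
- by apply: filterS (near_line _ oU (XiU _ Xi_xi)) => h; exact: df.
- by have [d2fi _] := d2f i; exact/d2fi/XiU.
Qed.

Local Notation gd i := (fun z => partial i (rd z) xi).
Local Notation gn i := (fun z => partial i (rn z) xi).
Local Notation hd i j := (fun z => partial i (partial j (rd z)) xi).
Local Notation hn i j := (fun z => partial i (partial j (rn z)) xi).

Let pointwise z : X z -> [/\
  forall i, a * q z * gd i z + b * (n z * gn i z) = 0,
  forall i j, a * q z * hd i j z + b * (n z * hn i j z) =
    a * q z * (gd i z * gd j z) + b * (n z * (gn i z * gn j z)),
  forall i, a * q z * (gd i z * gd c z) + b * (n z * (gn i z * gn c z)) =
    b * (n z * gn i z) &
  r_mix N M n p xi z * b_fun N M n p xi z = (a + b) / a * (n z * gn c z)].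
Proof.
move=> Xz; rewrite q_model//; have ab : 0 < a + b by rewrite addr_gt0.
(* Where [n] vanishes so does [p], and every term is zero. Elsewhere [b * n z] is positive, as the
   logistic identities require. *)
have [nz|nz] := eqVneq (n z) 0.
  have w0 (x y : R) : a * 0 * x + b * (0 * y) = 0.
    by rewrite mulr0 !mul0r mulr0 addr0.
  rewrite nz (supp Xz nz); split=> [i|i j|i|]; rewrite ?w0 ?mul0r ?mulr0//.
  by rewrite /b_fun nz mulr0 mul0r mulr0.
have bn : 0 < b * n z by rewrite mulr_gt0// lt_neqAle eq_sym nz n_ge0.
have pz y : 0 <= p z y by exact: p_ge0.
have [U [oU XiU eU]] := rd_exist Xz; have [W [oW XiW eW]] := rn_exist Xz.
(* The two losses may be derivable on different neighbourhoods, hence the intersection. *)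
have oUW := openI oU oW; have UWx : (U `&` W) xi by split; [exact: XiU|exact: XiW].
have D1 y i : (U `&` W) y -> derivable (rd z) y (delta_mx 0 i).
  by case=> Uy _; exact: (eU i).1.
have D2 y i : (U `&` W) y -> derivable (rn z) y (delta_mx 0 i).
  by case=> _ Wy; exact: (eW i).1.
have D3 y i j : (U `&` W) y -> derivable (partial j (rd z)) y (delta_mx 0 i).
  by case=> Uy _; exact: ((eU j).2 i).1.
have D4 y i j : (U `&` W) y -> derivable (partial j (rn z)) y (delta_mx 0 i).
  by case=> _ Wy; exact: ((eW j).2 i).1.
have pc h := p_normalizing h Xz.
split=> [i|i j|i|].
- by rewrite mulrA; exact: (weighted_score0 a_gt0 bn pz D1 D2 i UWx).
- rewrite !(mulrA b).
  exact: (weighted_information a_gt0 bn pz oUW D1 D2 D3 D4 i j UWx).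
- by rewrite !(mulrA b); exact: (weighted_score_normalizing a_gt0 bn pz D1 D2 pc UWx i).
have gnc := partial_rn_normalizing a_gt0 bn pz D1 D2 pc UWx.
have -> : n z * gn c z = a * p z xi * n z / (a * p z xi + b * n z).
  apply: (mulfI (lt0r_neq0 b_gt0)); rewrite mulrA; apply: etrans gnc _.
  by rewrite !mulrA; congr (_ / _); ring.
have D0 : 0 < a * p z xi + b * n z by rewrite ltr_wpDl// mulr_ge0// ltW.
rewrite /b_fun; have -> : r_mix N M n p xi z = (a * p z xi + b * n z) / (a + b).
  by rewrite /r_mix mulrDl; congr (_ + _); rewrite mulrAC.
by field; rewrite !lt0r_neq0.
Qed.

Let igd i : has_expect X q (gd i).
Proof.
apply: has_expect_square => //; first exact: partial_measurable.
by have [+ _] := moments i i; rewrite /gradient; under eq_fun do rewrite !mxE.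
Qed.

Let ign i : has_expect X n (gn i).
Proof.
apply: has_expect_square => //; first exact: partial_measurable.
by have [_] := moments i i; rewrite /gradient; under eq_fun do rewrite !mxE.
Qed.

Let igd2 i j : has_expect X q (fun z => gd i z * gd j z).
Proof.
by have [+ _] := moments i j; rewrite /gradient; under eq_fun do rewrite !mxE.
Qed.

Let ign2 i j : has_expect X n (fun z => gn i z * gn j z).
Proof.
by have [_] := moments i j; rewrite /gradient; under eq_fun do rewrite !mxE.
Qed.

(** Second derivatives are integrable by the domination in (N4), whereas the scores rely on the
    second moments of (N3). *)
Let ihd i j : has_expect X q (hd i j).
Proof.
have [bd [bn [ibd _ h]]] := dom; apply: has_expect_le ibd => //.
- by case: q_density.
- exact: partial2_measurable.
- by move=> z /h[_ _ /(_ _ Xi_xi i j i)[]].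
Qed.

Let ihn i j : has_expect X n (hn i j).
Proof.
have [bd [bn [_ ibn h]]] := dom; apply: has_expect_le ibn => //.
- exact: partial2_measurable.
- by move=> z /h[_ _ _ /(_ _ Xi_xi i j i)[]].
Qed.

Let scores i : a * expect X q (gd i) + b * expect X n (gn i) = 0.
Proof.
rewrite expect_mixture// (@eq_Rintegral _ _ _ _ _ (fun=> 0)); last first.
  by move=> z; rewrite inE => /pointwise[+ _ _ _]; exact.
by rewrite /Rintegral integral0.
Qed.

Let hessians i j :
  a * expect X q (hd i j) + b * expect X n (hn i j) =
  a * expect X q (fun z => gd i z * gd j z) +
  b * expect X n (fun z => gn i z * gn j z).
Proof.
rewrite !expect_mixture//; apply: eq_Rintegral => z.
by rewrite inE => /pointwise[_ + _ _]; exact.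
Qed.

Let normalizing_score i :
  a * expect X q (fun z => gd i z * gd c z) +
  b * expect X n (fun z => gn i z * gn c z) = b * expect X n (gn i).
Proof.
rewrite expect_mixture// -(RintegralZl _ mX (ign i)); apply: eq_Rintegral => z.
by rewrite inE => /pointwise[_ _ + _]; exact.
Qed.

Let expect_r : expect X (r_mix N M n p xi) (b_fun N M n p xi) =
  (a + b) / a * expect X n (gn c).
Proof.
rewrite -(RintegralZl _ mX (ign c)); apply: eq_Rintegral => z.
by rewrite inE => /pointwise[].
Qed.

Let JE i j : J_mx N M X n p q xi i j = (a + b)^-1 *
  (a * expect X q (fun z => gd i z * gd j z) +
   b * expect X n (fun z => gn i z * gn j z)).
Proof.
have Ed : expectmx X q (fun z => hessian (rd z) xi) i j = expect X q (hd i j).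
  by rewrite mxE; congr (expect X q _); apply/funext => z; rewrite mxE.
have En : expectmx X n (fun z => hessian (rn z) xi) i j = expect X n (hn i j).
  by rewrite mxE; congr (expect X n _); apply/funext => z; rewrite mxE.
rewrite -(hessians i j) -Ed -En; exact: mixture_mxE.
Qed.

Let covE f g i j : is_density X f -> has_expect X f (fun z => partial i (g z) xi) ->
  has_expect X f (fun z => partial j (g z) xi) ->
  has_expect X f (fun z => partial i (g z) xi * partial j (g z) xi) ->
  covmx X f (fun z => gradient (g z) xi) i j =
  expect X f (fun z => partial i (g z) xi * partial j (g z) xi) -
  expect X f (fun z => partial i (g z) xi) * expect X f (fun z => partial j (g z) xi).
Proof.
move=> df i1 i2 i12; rewrite -covariance_expect// mxE.
have gE k : (fun z => gradient (g z) xi 0 k) = (fun z => partial k (g z) xi).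
  by apply/funext => z; rewrite mxE.
by rewrite !gE; congr (expect X f _); apply/funext => z; rewrite !mxE.
Qed.

Let IE i j : I_mx N M X n p q xi i j = (a + b)^-1 *
  (a * (expect X q (fun z => gd i z * gd j z) -
        expect X q (gd i) * expect X q (gd j)) +
   b * (expect X n (fun z => gn i z * gn j z) -
        expect X n (gn i) * expect X n (gn j))).
Proof.
apply: etrans (mixture_mxE _ _ _ _ _ _) _; congr (_ * (a * _ + b * _)).
- exact: (@covE q rd i j q_density (igd i) (igd j) (igd2 i j)).
- exact: (@covE n rn i j n_density (ign i) (ign j) (ign2 i j)).
Qed.

Lemma mxtrace_I_J : J_mx N M X n p q xi \in unitmx ->
  \tr (I_mx N M X n p q xi *m invmx (J_mx N M X n p q xi)) =
  m%:R - expect X (r_mix N M n p xi) (b_fun N M n p xi).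
Proof.
move=> uJ; rewrite expect_r.
apply: (@mxtrace_moments _ _ _ _ a b _ _ _ _ c _ _ _ uJ JE IE scores normalizing_score).
- exact: lt0r_neq0.
- exact: lt0r_neq0.
- by rewrite lt0r_neq0// addr_gt0.
Qed.

End noise_contrastive_estimation.

(** * Specialization to the model with a normalizing parameter *)

Theorem lemma3 (R : realType) (d k N M : nat) (X : set (Rd R d))
    (q n : Rd R d -> R) (ptilde : Rd R d -> 'rV[R]_k -> R)
    (Theta : set 'rV[R]_k) (C : set R) (xistar : 'rV[R]_(k + 1))
    (N_gt0 : (0 < N)%N) (M_gt0 : (0 < M)%N)
    (mX : measurable X)
    (q_density : is_density X q)
    (n_density : is_density X n)
    (model : nonnormalized_model X ptilde Theta)
    (xistar_argmin :
      is_argmin (xi_space Theta C) (d_nce N M X n (pxi ptilde) q) xistar)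
    (q_model : forall x, X x -> q x = pxi ptilde x xistar)
    (hN1 : support_included X ptilde Theta n)
    (hN2 : log_model_C3 X ptilde Theta)
    (hN3 : finite_second_moments N M X n (pxi ptilde) q xistar)
    (hN4 : dominated N M X n (pxi ptilde) q (xi_space Theta C))
    (hN5 : J_mx N M X n (pxi ptilde) q xistar \in unitmx) :
  \tr (I_mx N M X n (pxi ptilde) q xistar *m
       invmx (J_mx N M X n (pxi ptilde) q xistar)) =
  (k + 1)%:R - expect X (r_mix N M n (pxi ptilde) xistar)
                        (b_fun N M n (pxi ptilde) xistar).
Proof.
have n_ge0 : forall z, X z -> 0 <= n z by case: n_density.
have [inXi _] := xistar_argmin; have [inTheta _] := inXi.
pose c := rshift k (ord0 : 'I_1).
apply: (@mxtrace_I_J _ _ _ N M X q n (pxi ptilde) (xi_space Theta C) xistar c) => //.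
- by move=> z y Xz; rewrite mulr_ge0 ?expR_ge0//; exact: model_ge0 model _ _ Xz.
- by move=> y; apply: measurable_funM => //; exact: model_measurable model _.
(* If [p] were nonzero at [z], dividing by the positive finite partition function would put [z] in
   the support of the normalized model, and (N1) would force [n z] to be positive. *)
- move=> z Xz nz; have [Z_gt0 Z_fin] := andP (model_normalizable model inTheta).
  apply/eqP; rewrite /pxi mulf_eq0 (gt_eqF (expR_gt0 _)) orbF; apply/negPn/negP => p0.
  suff : 0 < n z by rewrite nz ltxx.
  apply: hN1 inTheta _ _; split=> //=; apply: divr_gt0.
    by rewrite lt_neqAle eq_sym p0; exact: model_ge0 model _ _ Xz.
  by apply: fine_gt0; rewrite Z_gt0.
(* Moving along the last coordinate fixes [theta] and adds [h] to the log-density. *)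
- move=> z h Xz; rewrite /pxi /theta_of /c_of.
  have -> : lsubmx (h *: delta_mx 0 c + xistar) = lsubmx xistar.
    apply/rowP => i; rewrite !mxE eq_lrshift andbF mulr0 add0r//.
  by rewrite !mxE !eqxx mulr1 expRD mulrA mulrAC.
Qed.
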